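(* Let $\mathcal M\cong\mathbb R^{d+2}$ with coordinates $(u,t,x^i)$, $i=1,\dots,d$, be equipped with the vector field $\xi=\partial_u$, the 1-form $\psi=dt$ and the field $\gamma=\delta_{ij}\,dx^i\vee dx^j$ of symmetric bilinear forms on $\ker\psi$ (the ambient Aristotle spacetime). (1) The infinite-dimensional algebra $\mathfrak{leib}_\infty(d+2)$ of infinitesimal isometries of $(\mathcal M,\xi,\psi,\gamma)$, i.e. the algebra of vector fields $X$ on $\mathcal M$ satisfying $\mathcal L_X\xi=\mathcal L_X\psi=\mathcal L_X\gamma=0$, is spanned by the vector fields of the form $$X=a(t,x^i)\,\partial_u+\tau\,\partial_t+\big[\lambda^i{}_j(t)\,x^j+b^i(t)\big]\partial_i ,$$ where $a$ is an arbitrary function of $t$ and $x^i$, $\lambda$ (resp. $b$) is an arbitrary $\mathfrak o(d)$-valued (resp. $\mathbb R^d$-valued) function of $t$ only, and $\tau\in\mathbb R$ is a constant. (2) The finite-dimensional subalgebra $\mathfrak{leib}(d+2)=\mathfrak{leib}_\infty(d+2)\cap\mathfrak{igl}(d+2)$ of affine infinitesimal isometries, i.e. of those vector fields in $\mathfrak{leib}_\infty(d+2)$ whose second partial derivatives vanish, is generated by the vector fields $$M=\partial_u,\quad H=\partial_t,\quad P_i=\partial_i,\quad C=t\,\partial_u,\quad D_i=x_i\partial_u,\quad K_i=x_i\partial_u-t\,\partial_i,\quad J_{ij}=x_i\partial_j-x_j\partial_i .$$ These generators satisfy the (schematic) commutation relations $$[H,C]\sim M,\quad [\mathbf P,\mathbf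 K]\sim M,\quad [\mathbf P,\mathbf D]\sim M,$$ $$[H,\mathbf K]\sim\mathbf P,\quad [\mathbf D,\mathbf K]\sim C,\quad [\mathbf P,\mathbf J]\sim\mathbf P,$$ $$[\mathbf K,\mathbf J]\sim\mathbf K,\quad [\mathbf D,\mathbf J]\sim\mathbf D,\quad [\mathbf J,\mathbf J]\sim\mathbf J .$$
   Context: Indices $i,j$ are raised and lowered with $\delta_{ij}$. The bracket is the Lie bracket of vector fields. Boldface letters $\mathbf P,\mathbf D,\mathbf K,\mathbf J$ stand for the families $(P_i),(D_i),(K_i),(J_{ij})$. The schematic notation $[\mathbf X,\mathbf Y]\sim\mathbf Z$ means that the bracket of a generator of type $\mathbf X$ with a generator of type $\mathbf Y$ is a linear combination of generators of type $\mathbf Z$, with indices, signs and numerical coefficients suppressed. $\mathfrak{o}(d)$ denotes the antisymmetric real $d\times d$ matrices, and $\mathfrak{igl}(d+2)$ the Lie algebra of affine vector fields on $\mathbb R^{d+2}$ (components of degree at most one in the coordinates $(u,t,x^i)$). $\gamma$ is defined only on the distribution $\ker\psi$; for $X$ with $\mathcal L_X\psi=0$ one has $(\mathcal L_X\gamma)(V,W)=X[\gamma(V,W)]-\gamma([X,V],W)-\gamma(V,[X,W])$ for $V,W$ sections of $\ker\psi$. *)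

(* Defs.v *)
From HB Require Import structures.
From mathcomp Require Import all_boot all_order all_algebra.
From mathcomp Require Import all_classical all_reals all_analysis.
Import numFieldNormedType.Exports.

Set Implicit Arguments.
Unset Strict Implicit.
Unset Printing Implicit Defensive.

Import Order.TTheory GRing.Theory Num.Theory.
Local Open Scope classical_set_scope.
Local Open Scope ring_scope.

(* C^oo (for V of finite dimension): all iterated directional derivatives
   exist and are Fréchet differentiable, hence continuous. *)
Definition smooth (R : realType) (V W : normedModType R) (f : V -> W) : Prop :=
  forall (s : seq V) (p : V),
    differentiable (foldr (fun v (g : V -> W) => 'D_v g) f s) p.

Section LinearSpan.
Variables (R : realType) (E : lmodType R).

Definition lspan (S : set E) : set E :=
  [set x | exists n (c : 'I_n -> R) (z : 'I_n -> E),
     (forall k, S (z k)) /\ x = \sum_(k < n) c k *: z k].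

Definition is_subspace (A : set E) : Prop :=
  A 0 /\ forall (c : R) (x y : E), A x -> A y -> A (c *: x + y).

Definition finite_dimensional (A : set E) : Prop :=
  exists n (z : 'I_n -> E), A = lspan (range z).

End LinearSpan.

(* T is both the space of points and, at each point, the tangent space:
   a vector field p |-> X p on T acts on functions by f |-> 'D_(X p) f p. *)
Section VectorFields.
Variables (R : realType) (T : normedModType R).
Implicit Types (X Y V W : T -> T) (f : T -> R).

Definition deriv_along X f : T -> R := fun p => 'D_(X p) f p.

Definition bracket X Y : T -> T := fun p => 'D_(X p) Y p - 'D_(Y p) X p.

Definition ext_d f : T -> T -> R := fun p v => 'D_v f p.

Definition sym_prod (alpha beta : T -> T -> R) : T -> T -> T -> R :=
  fun p v w => (alpha p v * beta p w + alpha p w * beta p v) / 2.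

Definition lie_vfield X (xi : T -> T) : T -> T := bracket X xi.

Definition lie_form X (psi : T -> T -> R) V : T -> R :=
  fun p => deriv_along X (fun q => psi q (V q)) p - psi p (bracket X V p).

Definition lie_bilin X (gamma : T -> T -> T -> R) V W : T -> R :=
  fun p => deriv_along X (fun q => gamma q (V q) (W q)) p
           - gamma p (bracket X V p) (W p) - gamma p (V p) (bracket X W p).

Definition ker_section (psi : T -> T -> R) V : Prop :=
  smooth V /\ forall p, psi p (V p) = 0.

(* gamma matters only on ker psi: its Lie derivative is tested on sections of
   ker psi alone, whose brackets with X are again sections of ker psi. *)
Definition isometries (xi : T -> T) (psi : T -> T -> R)
    (gamma : T -> T -> T -> R) : set (T -> T) :=
  [set X | [/\ smooth X,
     forall p, lie_vfield X xi p = 0,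
     forall V, smooth V -> forall p, lie_form X psi V p = 0
   & forall V W, ker_section psi V -> ker_section psi W ->
       forall p, lie_bilin X gamma V W p = 0]].

Definition is_lie_subalgebra (A : set (T -> T)) : Prop :=
  [/\ forall X, A X -> smooth X, is_subspace A
    & forall X Y, A X -> A Y -> A (bracket X Y)].

Definition affine_vfields : set (T -> T) :=
  [set X | exists (L : {linear T -> T}) (c : T), X = fun p => L p + c].

(* [A, B] ~ Z *)
Definition bracket_sim (A B Z : set (T -> T)) : Prop :=
  forall X Y, A X -> B Y -> lspan Z (bracket X Y).

End VectorFields.

(* The point with coordinates (u, t, x^i) is (u, t, x). *)
Notation spacetime R d := (R * R * 'cV[R]_d)%type.

Section Ambient.
Variables (R : realType) (d : nat).
Local Notation M := (spacetime R d).

Definition t_coord (p : M) : R := p.1.2.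
Definition x_coord (i : 'I_d) (p : M) : R := p.2 i 0.

Definition e_u : M := (1, 0, 0).
Definition e_t : M := (0, 1, 0).
Definition e_x (i : 'I_d) : M := (0, 0, delta_mx i 0).
Definition coord_vectors : set M := [set e_u; e_t] `|` range e_x.

Definition xi : M -> M := fun=> e_u.
Definition psi : M -> M -> R := ext_d t_coord.
(* The factor 1/2 in [sym_prod] normalizes gamma(e_i, e_j) to delta_ij. *)
Definition gamma : M -> M -> M -> R := fun p v w =>
  \sum_(i < d) \sum_(j < d)
     (i == j)%:R * sym_prod (ext_d (x_coord i)) (ext_d (x_coord j)) p v w.

Definition leib_infty : set (M -> M) := isometries xi psi gamma.

Definition leib : set (M -> M) := leib_infty `&` @affine_vfields R M.

Definition isometry_form (a : R * 'cV[R]_d -> R) (tau : R)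
    (lambda : R -> 'M[R]_d) (b : R -> 'cV[R]_d) : M -> M := fun p =>
  let: (_, t, x) := p in
  a (t, x) *: e_u + tau *: e_t
  + \sum_(i < d) (\sum_(j < d) lambda t i j * x j 0 + b t i 0) *: e_x i.

Definition isometry_forms : set (M -> M) :=
  [set X | exists (a : R * 'cV[R]_d -> R) (tau : R)
                  (lambda : R -> 'M[R]_d) (b : R -> 'cV[R]_d),
     [/\ smooth a, smooth lambda, smooth b,
         forall t, (lambda t)^T = - lambda t
       & X = isometry_form a tau lambda b]].

(* Indices are lowered with delta_ij, so x_i = x^i. *)
Definition gen_M : M -> M := fun=> e_u.
Definition gen_H : M -> M := fun=> e_t.
Definition gen_P (i : 'I_d) : M -> M := fun=> e_x i.
Definition gen_C : M -> M := fun p => t_coord p *: e_u.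
Definition gen_D (i : 'I_d) : M -> M := fun p => x_coord i p *: e_u.
Definition gen_K (i : 'I_d) : M -> M :=
  fun p => x_coord i p *: e_u - t_coord p *: e_x i.
Definition gen_J (i j : 'I_d) : M -> M :=
  fun p => x_coord i p *: e_x j - x_coord j p *: e_x i.

Definition fam_M : set (M -> M) := [set gen_M].
Definition fam_H : set (M -> M) := [set gen_H].
Definition fam_P : set (M -> M) := range gen_P.
Definition fam_C : set (M -> M) := [set gen_C].
Definition fam_D : set (M -> M) := range gen_D.
Definition fam_K : set (M -> M) := range gen_K.
Definition fam_J : set (M -> M) := [set X | exists i j, X = gen_J i j].

Definition generators : set (M -> M) :=
  fam_M `|` fam_H `|` fam_P `|` fam_C `|` fam_D `|` fam_K `|` fam_J.

End Ambient.

Arguments coord_vectors R d : clear implicits.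
Arguments leib_infty R d : clear implicits.
Arguments leib R d : clear implicits.
Arguments isometry_forms R d : clear implicits.
Arguments fam_M R d : clear implicits.
Arguments fam_H R d : clear implicits.
Arguments fam_P R d : clear implicits.
Arguments fam_C R d : clear implicits.
Arguments fam_D R d : clear implicits.
Arguments fam_K R d : clear implicits.
Arguments fam_J R d : clear implicits.
Arguments generators R d : clear implicits.

(* Main.v *)
(* Write a vector field as X = (X^u, X^t, X^x). Invariance of xi says that X does
   not depend on u, and invariance of psi that all derivatives of X^t vanish, so
   X^t is a constant tau. Testing L_X gamma = 0 on V = W = (0, 0, y) shows that
   <X^x(t, x), y> does not change when x moves along y. Hence for fixed t the
   increments of X^x are orthogonal to the displacement, and polarization makes
   X^x(t, -) affine with antisymmetric linear part; no symmetry of second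
   derivatives is needed. The resulting normal form is visibly stable under
   brackets, contains the independent fields t^k d/du, and its affine members are
   combinations of the generators, t d/dx^i being D_i - K_i. *)
Require Import Defs.
From HB Require Import structures.
From mathcomp Require Import all_boot all_order all_algebra.
From mathcomp Require Import all_classical all_reals all_analysis.
From mathcomp Require Import ring.
Import numFieldNormedType.Exports.
Import Order.TTheory GRing.Theory Num.Theory.
Local Open Scope classical_set_scope.
Local Open Scope ring_scope.

Set Implicit Arguments.
Unset Strict Implicit.
Unset Printing Implicit Defensive.

(** [smooth] speaks of iterated derivatives in constant directions, so closure properties are proved
    by coinduction: one exhibits a class of differentiable functions that is stable under every
    ['D_v]. Brackets produce derivatives along directions that vary with the point; these are
    reduced to constant directions by expanding the direction in a basis. Integration is always
    one-dimensional: a derivative vanishing along [v] gives invariance under translation by [v], by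
    the mean value theorem on a line. The data of the normal form are never obtained by
    differentiating the field. The functions a, lambda, b and the constant tau are values of X, or
    differences of such values, at points with u = 0, so their smoothness is inherited by
    restriction to affine subspaces. In the same spirit, the coefficients of an affine isometry over
    the generators are read off at the origin and at the coordinate vectors. *)

Section DirectionalDerivative.
Variable R : realType.
Implicit Types U V W : normedModType R.

(** When [A] is affine along the line through [p], both difference quotients are the same function
    of [h]; derivability and the value of the derivative then transfer together, without a limit
    argument. *)
Lemma quotient_precomp U V W (A : U -> V) (f : V -> W) v w p :
  (forall h : R, A (h *: v + p) = h *: w + A p) ->
  (fun h : R => h^-1 *: ((f \o A \o shift p) (h *: v) - (f \o A) p)) =
  (fun h : R => h^-1 *: ((f \o shift (A p)) (h *: w) - f (A p))).
Proof. by move=> Aw; apply/funext => h /=; rewrite Aw. Qed.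

Lemma derive_precomp U V W (A : U -> V) (f : V -> W) v w p :
  (forall h : R, A (h *: v + p) = h *: w + A p) ->
  'D_v (f \o A) p = 'D_w f (A p).
Proof. by move=> /quotient_precomp Aw; rewrite /derive Aw. Qed.

Lemma derivable_precomp U V W (A : U -> V) (f : V -> W) v w p :
  (forall h : R, A (h *: v + p) = h *: w + A p) ->
  derivable f (A p) w -> derivable (f \o A) p v.
Proof. by move=> /quotient_precomp Aw; rewrite /derivable Aw. Qed.

(** The quotient is constantly [w] off [h = 0], and the limit is taken over punctured
    neighbourhoods. This is the source of the derivatives of coordinates, linear maps and affine
    fields. *)
Lemma derive_affine V W (f : V -> W) v w p :
  (forall h, f (h *: v + p) = h *: w + f p) -> 'D_v f p = w.
Proof.
move=> fw; apply/lim_near_cst => //=; near=> h.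
rewrite /= fw addrK scalerA mulVf ?scale1r //.
by near: h; exact: nbhs_dnbhs_neq.
Unshelve. all: by end_near. Qed.

Lemma derive_post V W W' (l : {linear W -> W'}) (f : V -> W) v p :
  continuous l -> derivable f p v -> 'D_v (l \o f) p = l ('D_v f p).
Proof.
move=> lc df; apply/cvg_lim => //.
rewrite (_ : (fun h => h^-1 *: _) =
  l \o (fun h => h^-1 *: ((f \o shift p) (h *: v) - f p))); last first.
  by apply/funext => h; rewrite /= -linearB -linearZZ.
exact: continuous_cvg (lc _) df.
Qed.

(** On the line [s *: v + p] the function becomes a real function of [s] with zero derivative, hence
    constant; compare [s = 0] with [s = 1]. Values are real because of the mean value theorem;
    fields are treated componentwise. *)
Lemma derive_shift_cst V (f : V -> R) v p :
  (forall q, derivable f q v) -> (forall q, 'D_v f q = 0) -> f (v + p) = f p.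
Proof.
move=> df f0; pose A (s : R) : V := s *: v + p.
have Aw s h : A (h *: (1 : R) + s) = h *: v + A s.
  by rewrite /A scaler1 scalerDl addrA.
rewrite -[v]scale1r -[RHS](congr1 f (_ : A 0 = p)); last first.
  by rewrite /A scale0r add0r.
rewrite [LHS](_ : _ = (f \o A) 1)//; apply: is_derive_0_is_cst => s; split.
- exact: (derivable_precomp (Aw s)).
- by rewrite (derive_precomp _ (Aw s)).
Qed.

End DirectionalDerivative.

(** * Closure properties of smooth maps *)

Section Smooth.
Variable R : realType.
Implicit Types U V W : normedModType R.

(** Smoothness is the largest property that implies differentiability and is inherited by
    directional derivatives. In each use, [P] describes the shape that all iterated derivatives
    share. *)
Lemma smooth_coind V W (P : (V -> W) -> Prop) :
  (forall f, P f -> (forall p, differentiable f p) /\ forall v, P ('D_v f)) ->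
  forall f, P f -> smooth f.
Proof.
move=> Pstep f Pf s; suff: P (foldr (fun v g => 'D_v g) f s).
  by move=> /Pstep[].
by elim: s => //= v s /Pstep[].
Qed.

Lemma smooth_diff V W (f : V -> W) p : smooth f -> differentiable f p.
Proof. exact: (fun fs => fs [::] p). Qed.

Lemma smooth_derivable V W (f : V -> W) p v : smooth f -> derivable f p v.
Proof. by move=> /smooth_diff df; exact: diff_derivable. Qed.

Lemma smooth_derive V W (f : V -> W) v : smooth f -> smooth ('D_v f).
(* [foldr] applies the last direction of the sequence first, so differentiating [f] beforehand means
   appending [v] at the end. *)
Proof. by move=> fs s p; rewrite -foldr_rcons; exact: fs. Qed.

Lemma smooth_cst V W (c : W) : smooth (fun _ : V => c).
Proof.
apply: (@smooth_coind V W (fun f => exists c, f = fun=> c)); last by exists c.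
move=> _ [{}c ->]; split=> [p|v]; first exact: differentiable_cst.
by exists 0; apply/funext => p; rewrite derive_cst.
Qed.

Lemma smooth_linear V W (l : {linear V -> W}) : continuous l -> smooth l.
Proof.
(* The derivatives of [l] are constants, so constants must belong to the class as well. *)
move=> lc; apply: (@smooth_coind V W
  (fun f => f = l \/ exists c, f = fun=> c)); last by left.
move=> _ [->|[c ->]]; split=> [p|v].
- exact: linear_differentiable.
- right; exists (l v); apply/funext => p.
  by apply: derive_affine => h; rewrite linearP.
- exact: differentiable_cst.
- by right; exists 0; apply/funext => p; rewrite derive_cst.
Qed.

Lemma smoothD V W (f g : V -> W) : smooth f -> smooth g ->
  smooth (fun p => f p + g p).
Proof.
move=> fs gs; apply: (@smooth_coind V W (fun h =>
  exists f g, [/\ smooth f, smooth g & h = fun p => f p + g p])); last first.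
  by exists f, g.
move=> _ [{fs}f [{gs}g [fs gs ->]]]; split=> [p|v].
  by apply: differentiableD; exact: smooth_diff.
exists ('D_v f), ('D_v g); split; [exact: smooth_derive..|].
by apply/funext => p; rewrite deriveD//; exact: smooth_derivable.
Qed.

Lemma smooth_sum V W n (f : 'I_n -> V -> W) : (forall i, smooth (f i)) ->
  smooth (fun p => \sum_(i < n) f i p).
Proof.
move=> fs; elim: n f fs => [|n IHn] f fs.
  rewrite (_ : (fun p => _) = fun=> 0); first exact: smooth_cst.
  by apply/funext => p; rewrite big_ord0.
rewrite (_ : (fun p => _) =
    fun p => \sum_(i < n) f (widen_ord (leqnSn n) i) p + f ord_max p).
  by apply: smoothD => //; apply: IHn.
by apply/funext => p; rewrite big_ord_recr.
Qed.

Lemma smooth_post V W W' (l : {linear W -> W'}) (f : V -> W) :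
  continuous l -> smooth f -> smooth (fun p => l (f p)).
Proof.
move=> lc fs; apply: (@smooth_coind V W' (fun h =>
  exists2 f, smooth f & h = l \o f)); last by exists f.
move=> _ [{fs}f fs ->]; split=> [p|v].
  apply: differentiable_comp; [exact: smooth_diff|exact: linear_differentiable].
exists ('D_v f); first exact: smooth_derive.
by apply/funext => p /=; rewrite derive_post//; exact: smooth_derivable.
Qed.

(** The derivative of [f \o A] along [v] is ['D_(l v) f \o A], again a smooth map precomposed with
    [A]: the class is stable because [l v] does not depend on the point. *)
Lemma smooth_precomp U V W (A : U -> V) (l : U -> V) (f : V -> W) :
  (forall p, differentiable A p) ->
  (forall h v p, A (h *: v + p) = h *: l v + A p) ->
  smooth f -> smooth (fun p => f (A p)).
Proof.
move=> dA Al fs; apply: (@smooth_coind U W (fun h =>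
  exists2 f, smooth f & h = f \o A)); last by exists f.
move=> _ [{fs}f fs ->]; split=> [p|v].
  by apply: differentiable_comp => //; exact: smooth_diff.
exists ('D_(l v) f); first exact: smooth_derive.
by apply/funext => p; rewrite (derive_precomp _ (fun h => Al h v p)).
Qed.

Lemma smoothZl V W (f : V -> R) (w : W) : smooth f -> smooth (fun p => f p *: w).
Proof.
have lw : linear (fun r : R => r *: w) by move=> a r s; rewrite scalerDl scalerA.
pose lM := GRing.isLinear.Build _ _ _ _ _ lw.
pose l : {linear R -> W} := HB.pack (fun r : R => r *: w) lM.
by move=> fs; apply: (@smooth_post _ _ _ l) => //; exact: scalel_continuous.
Qed.

Lemma smoothZr V W (c : R) (f : V -> W) : smooth f -> smooth (fun p => c *: f p).
Proof.
move=> fs; apply: (@smooth_coind V W (fun h =>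
  exists2 f, smooth f & h = c \*: f)); last by exists f.
move=> _ [{fs}f fs ->]; split=> [p|v].
  by apply: differentiableZ; exact: smooth_diff.
exists ('D_v f); first exact: smooth_derive.
by apply/funext => p; rewrite deriveZ//; exact: smooth_derivable.
Qed.

Lemma smoothN V W (f : V -> W) : smooth f -> smooth (fun p => - f p).
Proof.
move=> /(smoothZr (-1)); rewrite (_ : (fun p => -1 *: f p) = fun p => - f p)//.
by apply/funext => p; rewrite scaleN1r.
Qed.

Lemma smoothB V W (f g : V -> W) : smooth f -> smooth g ->
  smooth (fun p => f p - g p).
Proof. by move=> fs gs; apply: smoothD => //; exact: smoothN. Qed.

(* Derivatives of a product are sums of products: the invariant that makes the
   coinduction in smoothM go through. *)
Inductive sum_of_products V : (V -> R) -> Prop :=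
| sum_of_products_mul (f g : V -> R) : smooth f -> smooth g ->
    sum_of_products (fun p => f p * g p)
| sum_of_products_add (f g : V -> R) : sum_of_products f -> sum_of_products g ->
    sum_of_products (fun p => f p + g p).

Lemma smoothM V (f g : V -> R) : smooth f -> smooth g ->
  smooth (fun p => f p * g p).
Proof.
move=> fs gs; apply: (@smooth_coind V R (@sum_of_products V)); last first.
  exact: sum_of_products_mul.
move=> h; elim=> {fs gs h}[{}f {}g fs gs|{}f {}g _ [df Df] _ [dg Dg]]; split.
- by move=> p; apply: differentiableM; exact: smooth_diff.
- move=> v; rewrite (_ : 'D_v _ =
    fun p => f p * 'D_v g p + g p * 'D_v f p).
    apply: sum_of_products_add; apply: sum_of_products_mul => //;
      exact: smooth_derive.
  by apply/funext => p; rewrite deriveM//; exact: smooth_derivable.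
- by move=> p; apply: differentiableD.
- move=> v; rewrite (_ : 'D_v _ = fun p => 'D_v f p + 'D_v g p).
    exact: sum_of_products_add.
  by apply/funext => p; rewrite deriveD//; exact: diff_derivable.
Qed.

Lemma smoothX V (f : V -> R) n : smooth f -> smooth (fun p => f p ^+ n).
Proof.
move=> fs; elim: n => [|n IHn]; first exact: smooth_cst.
rewrite (_ : (fun p => _) = fun p => f p * f p ^+ n); first exact: smoothM.
by apply/funext => p; rewrite exprS.
Qed.

Lemma smooth_mx V m n (F : V -> 'M[R]_(m, n)) :
  (forall i j, smooth (fun p => F p i j)) -> smooth F.
Proof.
move=> Fs; rewrite (_ : F = fun p => \sum_i \sum_j F p i j *: delta_mx i j).
  by apply: smooth_sum => i; apply: smooth_sum => j; exact: smoothZl.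
by apply/funext => p; exact: matrix_sum_delta.
Qed.

End Smooth.

(** * Components of pairs and matrices, and linearity of the derivative in its direction *)

Section Components.
Variable R : realType.
Implicit Types U V W : normedModType R.

Lemma continuous_fst_pair V W : continuous (fst : V * W -> V).
Proof. by move=> p; exact: cvg_fst. Qed.

Lemma continuous_snd_pair V W : continuous (snd : V * W -> W).
Proof. by move=> p; exact: cvg_snd. Qed.

Lemma smooth_fst U V W (f : U -> V * W) : smooth f -> smooth (fun p => (f p).1).
Proof.
by move=> fs; apply: (@smooth_post _ _ _ _ fst) => //; exact: continuous_fst_pair.
Qed.

Lemma smooth_snd U V W (f : U -> V * W) : smooth f -> smooth (fun p => (f p).2).
Proof.
by move=> fs; apply: (@smooth_post _ _ _ _ snd) => //; exact: continuous_snd_pair.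
Qed.

Lemma derive_fst U V W (f : U -> V * W) p v : derivable f p v ->
  ('D_v f p).1 = 'D_v (fun q => (f q).1) p.
Proof.
by move=> df; rewrite -(@derive_post _ _ _ _ fst)//; exact: continuous_fst_pair.
Qed.

Lemma derive_snd U V W (f : U -> V * W) p v : derivable f p v ->
  ('D_v f p).2 = 'D_v (fun q => (f q).2) p.
Proof.
by move=> df; rewrite -(@derive_post _ _ _ _ snd)//; exact: continuous_snd_pair.
Qed.

Lemma derive_entry V m n (F : V -> 'M[R]_(m, n)) p v i j : derivable F p v ->
  'D_v F p i j = 'D_v (fun q => F q i j) p.
Proof. by move=> dF; rewrite derive_mx// mxE. Qed.

Lemma smooth_entry V m n (F : V -> 'M[R]_(m, n)) i j : smooth F ->
  smooth (fun p => F p i j).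
Proof.
move=> Fs; apply: (@smooth_coind _ V R (fun h =>
  exists2 F : V -> 'M[R]_(m, n), smooth F & h = fun p => F p i j)); last first.
  by exists F.
move=> _ [{Fs}F Fs ->]; split=> [p|v].
  apply: (@differentiable_comp _ _ _ _ F (fun N : 'M[R]_(m, n) => N i j : R)).
    exact: smooth_diff.
  exact: differentiable_coord.
exists ('D_v F); first exact: smooth_derive.
by apply/funext => p; rewrite derive_entry//; exact: smooth_derivable.
Qed.

Lemma smooth_mulmx V m n k (F : V -> 'M[R]_(m, n)) (G : V -> 'M[R]_(n, k)) :
  smooth F -> smooth G -> smooth (fun p => F p *m G p).
Proof.
move=> Fs Gs; apply: smooth_mx => i j.
rewrite (_ : (fun p => _) = fun p => \sum_k F p i k * G p k j).
  by apply: smooth_sum => l; apply: smoothM; exact: smooth_entry.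
by apply/funext => p; rewrite mxE.
Qed.

Lemma smooth_id V : smooth (@id V).
Proof.
by have := @smooth_linear R V V idfun; apply => x; exact: cvg_id.
Qed.

Lemma smooth_pair U V W (f : U -> V) (g : U -> W) : smooth f -> smooth g ->
  smooth (fun p => (f p, g p)).
Proof.
move=> fs gs; apply: (@smooth_coind _ U (V * W)%type (fun h =>
  exists f g, [/\ smooth f, smooth g & h = fun p => (f p, g p)])); last first.
  by exists f, g.
move=> _ [{fs}f [{gs}g [fs gs ->]]]; split=> [p|v].
  by apply: differentiable_pair; exact: smooth_diff.
exists ('D_v f), ('D_v g); split; [exact: smooth_derive..|].
apply/funext => p; have df := smooth_diff p fs; have dg := smooth_diff p gs.
by rewrite !deriveE//; [rewrite diff_pair|exact: differentiable_pair].
Qed.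

Lemma deriveD_dir V W (f : V -> W) p v w : differentiable f p ->
  'D_(v + w) f p = 'D_v f p + 'D_w f p.
Proof. by move=> df; rewrite !deriveE// linearD. Qed.

Lemma deriveZ_dir V W (f : V -> W) p (c : R) v : differentiable f p ->
  'D_(c *: v) f p = c *: 'D_v f p.
Proof. by move=> df; rewrite !deriveE// linearZZ. Qed.

Lemma derive_sum_dir V W (f : V -> W) p n (v : 'I_n -> V) : differentiable f p ->
  'D_(\sum_i v i) f p = \sum_i 'D_(v i) f p.
Proof.
by move=> df; rewrite deriveE// linear_sum; apply: eq_bigr => i _; rewrite deriveE.
Qed.

Lemma derive_scale1 W (f : R -> W) c t :
  differentiable f t -> 'D_c f t = c *: 'D_1 f t.
Proof. by move=> df; rewrite -{1}[c]scaler1 deriveZ_dir. Qed.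

End Components.

(** * Coordinates on spacetime and the derivative of the normal form *)

Section Spacetime.
Variables (R : realType) (d : nat).
Local Notation M := (spacetime R d).

Lemma sum_e_x (c : 'I_d -> R) :
  \sum_i c i *: @e_x R d i = (0, 0, \col_i c i) :> M.
Proof.
have [s1 s2] : (\sum_i c i *: @e_x R d i).1 = 0 /\
    (\sum_i c i *: @e_x R d i).2 = \col_i c i.
  split; rewrite linear_sum.
    by apply: big1 => i _ /=; rewrite scaler0.
  apply/colP => i; rewrite mxE summxE (bigD1 i)//= big1 ?addr0.
    by rewrite !mxE !eqxx mulr1.
  by move=> j ji; rewrite !mxE eq_sym (negPf ji) mulr0.
by rewrite [LHS]surjective_pairing s1 s2.
Qed.

Lemma coord_expansion (v : M) :
  v = v.1.1 *: @e_u R d + v.1.2 *: @e_t R d + \sum_i v.2 i 0 *: @e_x R d i.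
Proof.
rewrite sum_e_x; case: v => [[u t] x]; congr (_, _, _) => /=.
- by rewrite scaler1 scaler0 !addr0.
- by rewrite scaler1 scaler0 addr0 add0r.
- by rewrite !scaler0 !add0r; apply/colP => i; rewrite mxE.
Qed.

Lemma isometry_formE a tau lambda b (p : M) :
  isometry_form a tau lambda b p =
  (a (p.1.2, p.2), tau, lambda p.1.2 *m p.2 + b p.1.2).
Proof.
case: p => [[u t] x] /=; rewrite sum_e_x; congr (_, _, _) => /=.
- by rewrite scaler1 scaler0 !addr0.
- by rewrite scaler1 scaler0 addr0 add0r.
- by rewrite !scaler0 !add0r; apply/colP => i; rewrite !mxE.
Qed.

Lemma smooth_t_coord : smooth (@t_coord R d).
Proof. exact/smooth_snd/smooth_fst/smooth_id. Qed.

Lemma smooth_position : smooth (fun p : M => p.2).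
Proof. exact/smooth_snd/smooth_id. Qed.

Lemma smooth_of_t (W : normedModType R) (f : R -> W) :
  smooth f -> smooth (fun p : M => f p.1.2).
Proof.
apply: (@smooth_precomp _ _ _ _ (@t_coord R d) (@t_coord R d)) => // p.
exact/smooth_diff/smooth_t_coord.
Qed.

Lemma smooth_of_tx (W : normedModType R) (f : R * 'cV[R]_d -> W) :
  smooth f -> smooth (fun p : M => f (p.1.2, p.2)).
Proof.
pose pr (p : M) := (p.1.2, p.2).
apply: (@smooth_precomp _ _ _ _ pr pr) => // p.
by apply/smooth_diff/smooth_pair; [exact: smooth_t_coord|exact: smooth_position].
Qed.

Lemma smooth_isometry_form a tau lambda b :
  smooth a -> smooth lambda -> smooth b ->
  smooth (@isometry_form R d a tau lambda b).
Proof.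
move=> sa sl sb; rewrite (_ : isometry_form _ _ _ _ = fun p : M =>
  (a (p.1.2, p.2), tau, lambda p.1.2 *m p.2 + b p.1.2)); last first.
  by apply/funext => p; rewrite isometry_formE.
apply: smooth_pair; first apply: smooth_pair.
- exact: smooth_of_tx.
- exact: smooth_cst.
- apply: smoothD; last exact: smooth_of_t.
  by apply: smooth_mulmx; [exact: smooth_of_t|exact: smooth_position].
Qed.

(** The spatial entry is the product rule for lambda(t) x + b(t), carried out on the scalar products
    [l k * x k] and resummed. The absence of [v.1.1] and the zero in the middle entry are what
    invariance of xi and psi will require. *)
Lemma derive_isometry_form a tau lambda b (p v : M) :
  smooth a -> smooth lambda -> smooth b ->
  'D_v (isometry_form a tau lambda b) p =
  ('D_(v.1.2, v.2) a (p.1.2, p.2), 0,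
   v.1.2 *: ('D_1 lambda p.1.2 *m p.2 + 'D_1 b p.1.2) + lambda p.1.2 *m v.2).
Proof.
move=> sa sl sb; have sX := @smooth_isometry_form a tau _ _ sa sl sb.
have dX : derivable _ p v := smooth_derivable sX.
have dX1 : derivable _ p v := smooth_derivable (smooth_fst sX).
have dX2 : derivable _ p v := smooth_derivable (smooth_snd sX).
rewrite [LHS]surjective_pairing [X in (X, _)]surjective_pairing.
congr (_, _, _).
- rewrite (derive_fst dX) (derive_fst dX1).
  rewrite (_ : (fun q => _) = a \o (fun q : M => (q.1.2, q.2))); last first.
    by apply/funext => q; rewrite isometry_formE.
  by rewrite (@derive_precomp _ _ _ _ _ _ _ (v.1.2, v.2)).
- rewrite (derive_fst dX) (derive_snd dX1).
  rewrite (_ : (fun q => _) = fun=> tau); first exact: derive_cst.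
  by apply/funext => q; rewrite isometry_formE.
- rewrite (derive_snd dX); apply/colP => i; rewrite (derive_entry _ _ dX2).
  pose l k : M -> R := fun q => lambda q.1.2 i k.
  pose x k : M -> R := fun q => q.2 k 0.
  have sl' k : smooth (l k) by exact/smooth_entry/smooth_of_t.
  have sx k : smooth (x k) by exact/smooth_entry/smooth_position.
  have sb' : smooth (fun q : M => b q.1.2 i 0) by exact/smooth_entry/smooth_of_t.
  rewrite (_ : (fun q => _) =
      \sum_k (l k * x k) + (fun q => b q.1.2 i 0)); last first.
    apply/funext => q; rewrite isometry_formE !mxE/=.
    by rewrite fctE fct_sumE.
  have dM k : derivable (l k * x k) p v.
    by apply: derivableM; exact: smooth_derivable.
  rewrite deriveD; [|exact: derivable_sum|exact: smooth_derivable].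
  rewrite derive_sum//.
  have Dl k : 'D_v (l k) p = v.1.2 * 'D_1 lambda p.1.2 i k.
    rewrite derive_entry; last exact: smooth_derivable.
    rewrite (@derive_precomp _ _ _ _ (fun q : M => q.1.2)
      (fun t => lambda t i k) v v.1.2)//.
    by rewrite derive_scale1//; exact/smooth_diff/smooth_entry.
  have Dx k : 'D_v (x k) p = v.2 k 0.
    by apply: derive_affine => h; rewrite /x/= !mxE.
  have -> : 'D_v (fun q : M => b q.1.2 i 0) p = v.1.2 * 'D_1 b p.1.2 i 0.
    rewrite derive_entry; last exact: smooth_derivable.
    rewrite (@derive_precomp _ _ _ _ (fun q : M => q.1.2)
      (fun t => b t i 0) v v.1.2)//.
    by rewrite derive_scale1//; exact/smooth_diff/smooth_entry.
  rewrite !mxE mulrDr addrAC; congr (_ + _).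
  rewrite mulr_sumr -big_split/=; apply: eq_bigr => k _.
  rewrite deriveM; [|exact: smooth_derivable..].
  by rewrite Dl Dx addrC; congr (_ + _); rewrite mulrA [RHS]mulrC.
Qed.

End Spacetime.

(** * Infinitesimal isometries are exactly the fields in normal form *)

Section Isometries.
Variables (R : realType) (d : nat).
Local Notation M := (spacetime R d).

Lemma psiE (p v : M) : psi p v = v.1.2.
Proof. exact: derive_affine. Qed.

(** The Kronecker delta keeps only the terms [i = j], where the two halves of [sym_prod] agree and
    the factor 1/2 cancels: what remains is the Euclidean product of the spatial parts. *)
Lemma gammaE (p v w : M) : gamma p v w = \sum_i v.2 i 0 * w.2 i 0.
Proof.
have dx i (q u : M) : ext_d (@x_coord R d i) q u = u.2 i 0.
  by apply: derive_affine => h; rewrite /x_coord /= !mxE.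
rewrite /gamma; apply: eq_bigr => i _; rewrite (bigD1 i)//= big1 ?addr0.
  rewrite eqxx mul1r /sym_prod !dx [w.2 i 0 * _]mulrC -mulr2n.
  by rewrite -[_ *+ 2]mulr_natr mulfK ?pnatr_eq0.
by move=> j ji; rewrite eq_sym (negPf ji) mul0r.
Qed.

Lemma bracket_cst (X : M -> M) (v p : M) :
  bracket X (fun=> v) p = - 'D_v X p.
Proof. by rewrite /bracket derive_cst add0r. Qed.

Lemma deriv_along_cst (X : M -> M) (c : R) p : deriv_along X (fun=> c) p = 0.
Proof. exact: derive_cst. Qed.

Lemma isometry_derive_u (X : M -> M) p : leib_infty R d X -> 'D_(@e_u R d) X p = 0.
Proof.
move=> [_ /(_ p) + _ _]; rewrite /lie_vfield bracket_cst => /eqP.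
by rewrite oppr_eq0 => /eqP.
Qed.

(** Tested on a constant field [v], psi(v) is constant and the bracket is [- 'D_v X], so only the
    t-component of ['D_v X] survives. *)
Lemma isometry_derive_t (X : M -> M) p v : leib_infty R d X -> ('D_v X p).1.2 = 0.
Proof.
move=> [_ _ Xpsi _]; have := Xpsi (fun=> v) (@smooth_cst _ _ _ v) p.
rewrite /lie_form (_ : (fun q => psi q v) = fun=> v.1.2).
  by rewrite deriv_along_cst psiE bracket_cst sub0r /= opprK.
by apply/funext => q; rewrite psiE.
Qed.

(* The Killing equation of gamma, contracted twice with the same vector. *)
Lemma isometry_derive_x (X : M -> M) p y : leib_infty R d X ->
  \sum_i ('D_(0, 0, y) X p).2 i 0 * y i 0 = 0.
Proof.
have kery : ker_section (@psi R d) (fun=> (0, 0, y)).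
  by split; [exact: smooth_cst|move=> q; rewrite psiE].
move=> [_ _ _ /(_ _ _ kery kery p)]; rewrite /lie_bilin.
rewrite (_ : (fun q => gamma q _ _) = fun=> \sum_i y i 0 * y i 0); last first.
  by apply/funext => q; rewrite gammaE.
rewrite deriv_along_cst !gammaE !bracket_cst sub0r/=.
under [X in _ - X]eq_bigr do rewrite mulrC.
rewrite -opprD -mulr2n => /eqP; rewrite oppr_eq0 mulrn_eq0/= => /eqP.
under eq_bigr do rewrite mxE mulNr.
by rewrite sumrN => /eqP; rewrite oppr_eq0 => /eqP.
Qed.

Lemma mxB_entry m n (A B : 'M[R]_(m, n)) i j : (A - B) i j = A i j - B i j.
Proof. by rewrite !mxE. Qed.

Lemma dotmxE n (x y : 'cV[R]_n) : (x^T *m y) 0 0 = \sum_i x i 0 * y i 0.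
Proof. by rewrite mxE; apply: eq_bigr => i _; rewrite mxE. Qed.

(* A map R^d -> R^d all of whose increments are orthogonal to the displacement
   is affine with antisymmetric linear part: with W := Z - Z 0, polarizing
   <W x, x> = 0 = <W y - W x, y - x> gives <W x, y> = - <W y, x>, whose right-hand
   side is linear in x. *)
Lemma orthogonal_increments_affine (Z : 'cV[R]_d -> 'cV[R]_d) :
  (forall x y, \sum_i (Z (y + x)) i 0 * y i 0 = \sum_i (Z x) i 0 * y i 0) ->
  let A := \matrix_(i, j) (Z 0 j 0 - Z (delta_mx i 0) j 0) in
  A^T = - A /\ forall x, Z x = A *m x + Z 0.
Proof.
move=> ZH A; pose W x := Z x - Z 0.
have incr x y : (W (y + x) - W x)^T *m y = 0.
  rewrite /W opprB addrA subrK raddfB/= mulmxBl; apply/matrixP => i j.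
  by rewrite !ord1 mxB_entry !dotmxE ZH subrr mxE.
have W0 : W 0 = 0 by rewrite /W subrr.
have Wx x : (W x)^T *m x = 0 by have := incr 0 x; rewrite addr0 W0 subr0.
have pol x y : (W x)^T *m y = - ((W y)^T *m x).
  have := incr x (y - x); rewrite subrK mulmxBr raddfB/= !mulmxBl !Wx.
  rewrite sub0r subr0 => /eqP; rewrite subr_eq0 => /eqP <-.
  by rewrite opprK.
(* Polarization against a basis vector: <W x, e_i> = - <W e_i, x>. This accounts for the sign and
   the order of the indices in [A]. *)
have We i x : W x i 0 = - \sum_j W (delta_mx i 0) j 0 * x j 0.
  have := congr1 (fun B : 'M[R]_1 => B 0 0) (pol x (delta_mx i 0)).
  rewrite [RHS]mxE !dotmxE => <-; rewrite (bigD1 i)//= big1 => [|j ji].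
    by rewrite addr0 [X in _ * X]mxE !eqxx mulr1.
  by rewrite [X in _ * X]mxE (negPf ji) mulr0.
have WA i j : A i j = - W (delta_mx i 0) j 0.
  by rewrite !mxE opprB.
split=> [|x].
  apply/matrixP => i j; rewrite mxE [RHS]mxE !WA opprK We.
  rewrite opprK (bigD1 j)//= big1 => [|k kj].
    by rewrite addr0 [X in _ * X]mxE !eqxx mulr1.
  by rewrite [X in _ * X]mxE (negPf kj) mulr0.
rewrite -[LHS](subrK (Z 0)) -/(W x); congr (_ + _); apply/colP => i.
by rewrite We mxE -sumrN; apply: eq_bigr => j _; rewrite WA mulNr.
Qed.

Lemma derive_shift_field (X : M -> M) (v p : M) : smooth X ->
  (forall q, 'D_v X q = 0) -> X (v + p) = X p.
Proof.
move=> sX X0.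
have dX q : derivable X q v by exact: smooth_derivable.
have sX1 := smooth_fst sX; have sX2 := smooth_snd sX.
rewrite [LHS]surjective_pairing [X in (X, _)]surjective_pairing.
rewrite [RHS]surjective_pairing [X in _ = (X, _)]surjective_pairing.
congr (_, _, _).
- apply: (@derive_shift_cst _ _ (fun q => (X q).1.1)) => q.
    exact/smooth_derivable/smooth_fst.
  by rewrite -(derive_fst (smooth_derivable sX1)) -derive_fst// X0.
- apply: (@derive_shift_cst _ _ (fun q => (X q).1.2)) => q.
    exact/smooth_derivable/smooth_snd.
  by rewrite -(derive_snd (smooth_derivable sX1)) -derive_fst// X0.
- apply/colP => i; apply: (@derive_shift_cst _ _ (fun q => (X q).2 i 0)) => q.
    exact/smooth_derivable/smooth_entry.
  rewrite -(derive_entry _ _ (smooth_derivable sX2)) -derive_snd// X0.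
  by rewrite mxE.
Qed.

Lemma isometry_u_invariant (X : M -> M) p : leib_infty R d X ->
  X p = X (0, p.1.2, p.2).
Proof.
move=> LX; have [sX _ _ _] := LX.
rewrite -(@derive_shift_field X (p.1.1 *: @e_u R d) (0, p.1.2, p.2))//.
  congr X; case: p => [[u t] x]; rewrite /e_u; congr (_, _, _) => /=.
  - by rewrite scaler1 addr0.
  - by rewrite scaler0 add0r.
  - by rewrite scaler0 add0r.
move=> q; rewrite deriveZ_dir ?isometry_derive_u ?scaler0//.
exact: smooth_diff.
Qed.

Lemma isometry_t_component (X : M -> M) p : leib_infty R d X ->
  (X p).1.2 = (X 0).1.2.
Proof.
move=> LX; have [sX _ _ _] := LX; have sX1 := smooth_fst sX.
rewrite -{1}[p]addr0; apply: (@derive_shift_cst _ _ (fun q => (X q).1.2)) => q.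
  exact/smooth_derivable/smooth_snd.
rewrite -(derive_snd (smooth_derivable sX1)) -derive_fst.
  exact: isometry_derive_t.
exact: smooth_derivable.
Qed.

Lemma isometry_increment (X : M -> M) p y : leib_infty R d X ->
  \sum_i (X ((0, 0, y) + p)).2 i 0 * y i 0 = \sum_i (X p).2 i 0 * y i 0.
Proof.
move=> LX; have [sX _ _ _] := LX; have sX2 := smooth_snd sX.
pose g i : M -> R := fun q => (X q).2 i 0.
have dg i q v : derivable (g i) q v by exact/smooth_derivable/smooth_entry.
pose f := \sum_i y i 0 *: g i.
have fE q : f q = \sum_i (X q).2 i 0 * y i 0.
  by rewrite /f fct_sumE; apply: eq_bigr => i _; rewrite mulrC.
rewrite -!fE; apply: derive_shift_cst => q.
  by apply: derivable_sum => i; exact: derivableZ.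
rewrite derive_sum; last by move=> i; exact: derivableZ.
rewrite -[RHS](isometry_derive_x q y LX); apply: eq_bigr => i _.
rewrite deriveZ// [RHS]mulrC; congr (_ * _).
by rewrite derive_snd ?derive_entry//; exact: smooth_derivable.
Qed.

Lemma isometry_is_form (X : M -> M) : leib_infty R d X -> isometry_forms R d X.
Proof.
move=> LX; have [sX _ _ _] := LX.
(* The spatial part on the slice u = 0; with [t] frozen, [Z t] has increments orthogonal to the
   displacement. *)
pose Z t x := (X (0, t, x)).2.
pose A t := \matrix_(i, j) (Z t 0 j 0 - Z t (delta_mx i 0) j 0).
have ZA t : (A t)^T = - A t /\ forall x, Z t x = A t *m x + Z t 0.
  apply: orthogonal_increments_affine => x y.
  rewrite -[RHS](isometry_increment _ _ LX) /Z.
  rewrite (_ : (0, t, y + x) = (0, 0, y) + (0, t, x) :> M)//.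
  by congr (_, _, _); rewrite add0r.
have sZ x : smooth (Z ^~ x).
  apply: smooth_snd; pose l (t : R) : M := (0, t, 0).
  apply: (@smooth_precomp _ _ _ _ (fun t : R => (0, t, x) : M) l) => //.
    move=> t; apply: smooth_diff; apply: smooth_pair; last exact: smooth_cst.
    by apply: smooth_pair; [exact: smooth_cst|exact: smooth_id].
  move=> h v t; rewrite /l; congr (_, _, _) => /=.
  - by rewrite scaler0 addr0.
  - by rewrite scaler0 add0r.
exists (fun q => (X (0, q.1, q.2)).1.1), (X 0).1.2, A, (Z ^~ 0); split=> //.
- do 2 apply: smooth_fst; pose l (q : R * 'cV[R]_d) : M := (0, q.1, q.2).
  apply: (@smooth_precomp _ _ _ _ l l) => //.
    move=> q; apply: smooth_diff; apply: smooth_pair; last first.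
      exact/smooth_snd/smooth_id.
    by apply: smooth_pair; [exact: smooth_cst|exact/smooth_fst/smooth_id].
  move=> h v q; rewrite /l; congr (_, _, _) => /=.
  by rewrite scaler0 addr0.
(* The entries of [A t] are differences of values of [Z t] at fixed points, so they are smooth in
   [t] by restricting X to lines. *)
- apply: smooth_mx => i j; rewrite (_ : (fun t => _) =
    fun t => Z t 0 j 0 - Z t (delta_mx i 0) j 0).
    by apply: smoothB; exact: smooth_entry.
  by apply/funext => t; rewrite mxE.
- by move=> t; have [] := ZA t.
- apply/funext => p; rewrite isometry_formE -(ZA _).2 -(isometry_t_component p LX).
  rewrite {1}isometry_u_invariant//.
  by rewrite /Z -isometry_u_invariant// -!surjective_pairing.
Qed.

Lemma skew_sum (A : 'M[R]_d) (v w : 'cV[R]_d) : A^T = - A ->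
  \sum_i ((A *m v) i 0 * w i 0 + v i 0 * (A *m w) i 0) = 0.
Proof.
move=> sA; rewrite big_split/= -!dotmxE trmx_mul sA mulmxN mulNmx mxE mulmxA.
by rewrite addNr.
Qed.

(** For gamma, the terms where V and W are differentiated along X cancel between the product rule
    and the two brackets. What remains is <lambda V, W> + <V, lambda W>, which vanishes by
    antisymmetry. *)
Lemma form_is_isometry (X : M -> M) : isometry_forms R d X -> leib_infty R d X.
Proof.
move=> [a [tau [l [b [sa sl sb ls ->]]]]] {X}; set X := isometry_form _ _ _ _.
have sX : smooth X by exact: smooth_isometry_form.
have DX p v : 'D_v X p = _ := derive_isometry_form tau p v sa sl sb.
split=> // [p|V sV p|V W [sV kV] [sW kW] p].
- rewrite /lie_vfield bracket_cst DX /= !scale0r mulmx0 addr0.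
  by rewrite derive0 oppr0.
- rewrite /lie_form (_ : (fun q => psi q (V q)) = fun q => (V q).1.2); last first.
    by apply/funext => q; rewrite psiE.
  rewrite psiE /deriv_along /bracket /= DX /= subr0.
  rewrite (derive_fst (smooth_derivable sV)).
  by rewrite (derive_snd (smooth_derivable (smooth_fst sV))) subrr.
(* Sections of ker psi have no t-component, so the derivatives of lambda and b with respect to [t]
   disappear from ['D_(V p) X] and ['D_(W p) X]. *)
- have kV' q : (V q).1.2 = 0 by rewrite -[RHS](kV q) psiE.
  have kW' q : (W q).1.2 = 0 by rewrite -[RHS](kW q) psiE.
  rewrite /lie_bilin !gammaE /deriv_along.
  pose v i : M -> R := fun q => (V q).2 i 0.
  pose w i : M -> R := fun q => (W q).2 i 0.
  have dv i : derivable (v i) p (X p).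
    exact/smooth_derivable/smooth_entry/smooth_snd.
  have dw i : derivable (w i) p (X p).
    exact/smooth_derivable/smooth_entry/smooth_snd.
  rewrite (_ : (fun q => _) = \sum_i (v i * w i)); last first.
    by apply/funext => q; rewrite gammaE fct_sumE.
  rewrite derive_sum; last by move=> i; exact: derivableM.
  have sA := skew_sum (V p).2 (W p).2 (ls p.1.2).
  rewrite -!sumrB -[RHS]sA; apply: eq_bigr => i _.
  rewrite deriveM// /bracket !DX /= kV' kW' !scale0r !add0r.
  have Dv : 'D_(X p) (v i) p = ('D_(X p) V p).2 i 0.
    rewrite derive_snd ?derive_entry//; first exact/smooth_derivable/smooth_snd.
    exact: smooth_derivable.
  have Dw : 'D_(X p) (w i) p = ('D_(X p) W p).2 i 0.
    rewrite derive_snd ?derive_entry//; first exact/smooth_derivable/smooth_snd.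
    exact: smooth_derivable.
  rewrite Dv Dw !mxB_entry.
  move: ('D_(X p) V p).2 ('D_(X p) W p).2 => dV dW.
  rewrite -[v i p *: _]/((V p).2 i 0 * _) -[w i p *: _]/((W p).2 i 0 * _).
  set AV := (_ *m (V p).2) i 0; set AW := (_ *m (W p).2) i 0.
  ring.
Qed.

Lemma leib_inftyE : leib_infty R d = isometry_forms R d.
Proof.
apply/seteqP; split=> X; [exact: isometry_is_form|exact: form_is_isometry].
Qed.

End Isometries.

(** * Spans, subspaces and linear dependence *)

Section Span.
Variables (R : realType) (E : lmodType R).
Implicit Types (S A : set E).

Lemma subspaceD A x y : is_subspace A -> A x -> A y -> A (x + y).
Proof. by move=> [_ Alin] Ax Ay; rewrite -[x]scale1r; exact: Alin. Qed.

Lemma subspaceZ A c x : is_subspace A -> A x -> A (c *: x).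
Proof. by move=> [A0 Alin] Ax; rewrite -[_ *: _]addr0; exact: Alin. Qed.

Lemma subspaceN A x : is_subspace A -> A x -> A (- x).
Proof. by move=> As Ax; rewrite -scaleN1r; exact: subspaceZ. Qed.

Lemma subspaceB A x y : is_subspace A -> A x -> A y -> A (x - y).
Proof. by move=> As Ax Ay; apply: subspaceD => //; exact: subspaceN. Qed.

Lemma subspace_sum A n (x : 'I_n -> E) : is_subspace A ->
  (forall i, A (x i)) -> A (\sum_i x i).
Proof.
move=> As Ax; elim/big_ind : _ => //; first by case: As.
by move=> u v Au Av; exact: subspaceD.
Qed.

Lemma lspan_incl S : S `<=` lspan S.
Proof.
move=> x Sx; exists 1, (fun=> 1), (fun=> x); split=> //.
by rewrite big_ord1 scale1r.
Qed.

Lemma lspan_subspace S : is_subspace (lspan S).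
Proof.
split; first by exists 0, (fun=> 0), (fun=> 0); split; [case|rewrite big_ord0].
move=> c _ _ [m [a [x [Sx ->]]]] [n [b [y [Sy ->]]]].
exists (m + n)%N.
exists (fun k => match fintype.split k with inl i => c * a i | inr j => b j end).
exists (fun k => match fintype.split k with inl i => x i | inr j => y j end); split.
  by move=> k; case: (fintype.split k).
rewrite big_split_ord/= scaler_sumr; congr (_ + _); apply: eq_bigr => i _.
  by rewrite -[lshift n i]/(unsplit (inl i)) unsplitK scalerA.
by rewrite -[rshift m i]/(unsplit (inr i)) unsplitK.
Qed.

Lemma lspan_min S A : is_subspace A -> S `<=` A -> lspan S `<=` A.
Proof.
move=> As SA _ [n [c [z [Sz ->]]]].
by apply: subspace_sum => // k; apply: subspaceZ => //; exact: SA.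
Qed.

Lemma lspan_id A : is_subspace A -> lspan A = A.
Proof.
by move=> As; apply/seteqP; split; [exact: lspan_min|exact: lspan_incl].
Qed.

Lemma lspan_range n (z : 'I_n -> E) x : lspan (range z) x ->
  exists c : 'I_n -> R, x = \sum_k c k *: z k.
Proof.
apply: (@lspan_min _ [set y | exists c : 'I_n -> R, y = \sum_k c k *: z k]).
- split=> [|c _ _ [a ->] [b ->]].
    by exists (fun=> 0); rewrite big1// => k _; rewrite scale0r.
  exists (fun k => c * a k + b k); rewrite scaler_sumr -big_split/=.
  by apply: eq_bigr => k _; rewrite scalerDl scalerA.
- move=> _ [k _ <-]; exists (fun j => (j == k)%:R).
  rewrite (bigD1 k)//= eqxx scale1r big1 ?addr0// => j jk.
  by rewrite (negPf jk) scale0r.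
Qed.

(** Writing the first n + 1 vectors over the n spanning ones gives an (n + 1) x n matrix; its rank
    is at most n, so its left kernel contains a nonzero row, which is the dependence. *)
Lemma finite_dimensional_dependent A n (y : nat -> E) (z : 'I_n -> E) :
  A = lspan (range z) -> (forall k, A (y k)) ->
  exists2 c : 'I_n.+1 -> R, exists k, c k != 0 & \sum_k c k *: y k = 0.
Proof.
move=> Az Ay.
have /choice[w yE] : forall k, exists c : 'I_n -> R, y k = \sum_j c j *: z j.
  by move=> k; apply: lspan_range; rewrite -Az.
pose W := \matrix_(k < n.+1, j < n) w k j.
have kW : kermx W != 0.
  rewrite -mxrank_eq0 mxrank_ker subn_eq0 -ltnNge ltnS.
  exact: rank_leq_col.
have [v vW v0] : exists2 v : 'rV_n.+1, v *m W = 0 & v != 0.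
  have [i ki] : exists i, row i (kermx W) != 0.
    apply/existsP; apply: contraNT kW => /existsPn k0.
    by apply/eqP/row_matrixP => i; rewrite row0; apply/eqP; rewrite -[_ == _]negbK k0.
  by exists (row i (kermx W)) => //; apply: sub_kermxP; exact: row_sub.
exists (v 0).
  apply/existsP; apply: contraNT v0 => /existsPn k0.
  by apply/eqP/rowP => k; rewrite mxE; apply/eqP; rewrite -[_ == _]negbK k0.
under eq_bigr do rewrite yE scaler_sumr.
rewrite exchange_big/= big1// => j _.
under eq_bigr do rewrite scalerA.
rewrite -scaler_suml; have /matrixP/(_ 0 j) := vW; rewrite !mxE.
by under eq_bigr do rewrite mxE; move=> ->; rewrite scale0r.
Qed.

End Span.

(** Bookkeeping for the spatial part of a bracket of normal forms: the odd-numbered terms will be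
    those linear in x, the even-numbered ones those depending on t alone. *)
Lemma addr_regroup (V : zmodType) (e1 e2 e3 e4 f1 f2 f3 f4 : V) :
  e1 + e2 + (e3 + e4) - (f1 + f2 + (f3 + f4)) =
  e1 - f1 + (e3 - f3) + (e2 - f2 + (e4 - f4)).
Proof.
by rewrite !opprD addrACA [X in X + _]addrACA [X in _ + X]addrACA addrACA.
Qed.

(** * The isometries form an infinite-dimensional Lie algebra *)

Section IsometryAlgebra.
Variables (R : realType) (d : nat).
Local Notation M := (spacetime R d).

Lemma isometry_forms_subspace : is_subspace (isometry_forms R d).
Proof.
split.
  exists (fun=> 0), 0, (fun=> 0), (fun=> 0).
  split; try exact: smooth_cst; first by move=> t; rewrite trmx0 oppr0.
  apply/funext => p; rewrite isometry_formE mul0mx addr0.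
  by [].
move=> c _ _ [a [tau [l [b [sa sl sb ls ->]]]]]
  [a' [tau' [l' [b' [sa' sl' sb' ls' ->]]]]].
exists (fun q => c *: a q + a' q), (c * tau + tau'),
  (fun t => c *: l t + l' t), (fun t => c *: b t + b' t).
split; try (by apply: smoothD => //; exact: smoothZr).
- by move=> t; rewrite linearD linearZ/= ls ls' scalerN opprD.
- apply/funext => p; rewrite isometry_formE.
  rewrite [LHS](_ : _ = c *: isometry_form a tau l b p +
    isometry_form a' tau' l' b' p)// !isometry_formE.
  by congr (_, _, _); rewrite /= mulmxDl -scalemxAl scalerDr addrACA.
Qed.

(** [smooth] controls constant directions only. Differentiability makes the derivative linear in its
    direction, so it becomes a combination of fixed partial derivatives with smooth coefficients. *)
Lemma smooth_directional (f : R * 'cV[R]_d -> R) (c : R)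
    (w : R * 'cV[R]_d -> 'cV[R]_d) : smooth f -> smooth w ->
  smooth (fun q => 'D_(c, w q) f q).
Proof.
move=> sf sw; rewrite (_ : (fun q => _) = fun q =>
  c *: 'D_(1, 0) f q + \sum_i w q i 0 * 'D_(0, delta_mx i 0) f q); last first.
  apply/funext => q; have df := smooth_diff q sf.
  rewrite -deriveZ_dir//.
  under eq_bigr do rewrite -[_ * _]/(_ *: _) -deriveZ_dir//.
  rewrite -derive_sum_dir// -deriveD_dir//; congr ('D_ _ f q).
  rewrite [RHS]surjective_pairing /= !linear_sum /=.
  congr (_, _).
    by rewrite scaler1 big1 ?addr0// => i _; rewrite scaler0.
  rewrite scaler0 add0r; apply/colP => i; rewrite summxE (bigD1 i)//= big1.
    by rewrite !mxE !eqxx mulr1 addr0.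
  by move=> j ji; rewrite !mxE eq_sym (negPf ji) mulr0.
apply: smoothD; first exact/smoothZr/smooth_derive.
apply: smooth_sum => i; apply: smoothM; first exact: smooth_entry.
exact: smooth_derive.
Qed.

Lemma derive_skew (l : R -> 'M[R]_d) t : smooth l ->
  (forall t, (l t)^T = - l t) -> ('D_1 l t)^T = - 'D_1 l t.
Proof.
move=> sl ls; apply/matrixP => i j; rewrite mxE [RHS]mxE.
rewrite !derive_entry; [|exact: smooth_derivable..].
rewrite -deriveN; last exact/smooth_derivable/smooth_entry.
congr ('D_1 _ t); apply/funext => s; rewrite fctE.
by have /matrixP/(_ i j) := ls s; rewrite !mxE.
Qed.

Lemma isometry_forms_bracket (X Y : M -> M) :
  isometry_forms R d X -> isometry_forms R d Y -> isometry_forms R d (bracket X Y).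
Proof.
move=> [a [tau [l [b [sa sl sb ls ->]]]]] [a' [tau' [l' [b' [sa' sl' sb' ls' ->]]]]].
(* The witnesses sort the terms of [derive_isometry_form] into those of the a, tau, lambda and b
   slots. The matrix commutator appears in reversed order, as the bracket of the fields A x and B x
   is (B A - A B) x. *)
exists (fun q => 'D_(tau, l q.1 *m q.2 + b q.1) a' q -
                 'D_(tau', l' q.1 *m q.2 + b' q.1) a q), 0,
  (fun t => tau *: 'D_1 l' t - tau' *: 'D_1 l t + (l' t *m l t - l t *m l' t)),
  (fun t => tau *: 'D_1 b' t - tau' *: 'D_1 b t + (l' t *m b t - l t *m b' t)).
have sw (k : R -> 'M[R]_d) (c : R -> 'cV[R]_d) : smooth k -> smooth c ->
    smooth (fun q : R * 'cV[R]_d => k q.1 *m q.2 + c q.1).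
  move=> sk sc.
  have s1 (W : normedModType R) (f : R -> W) : smooth f ->
      smooth (fun q : R * 'cV[R]_d => f q.1).
    apply: (@smooth_precomp _ _ _ _ fst fst) => // q.
    by apply: smooth_diff; apply: smooth_fst; exact: smooth_id.
  apply: smoothD; last exact: s1.
  by apply: smooth_mulmx; [exact: s1|apply: smooth_snd; exact: smooth_id].
split.
- by apply: smoothB; apply: smooth_directional => //; exact: sw.
- apply: smoothD; apply: smoothB; try exact/smoothZr/smooth_derive;
    exact: smooth_mulmx.
- apply: smoothD; apply: smoothB; try exact/smoothZr/smooth_derive;
    exact: smooth_mulmx.
- move=> t; rewrite linearD !linearB/= !linearZ/= !derive_skew// !trmx_mul !ls !ls'.
  rewrite !mulmxN !mulNmx !opprK !scalerN.
  by rewrite [- _ + _]addrC opprD !opprB.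
- apply/funext => p; rewrite isometry_formE /bracket !derive_isometry_form//.
  rewrite !isometry_formE /=; congr (_, _, _); first by rewrite subrr.
  rewrite !mulmxDl !mulNmx -!scalemxAl !mulmxDr !mulmxA !scalerDr.
  exact: addr_regroup.
Qed.

Lemma leib_infty_lie : is_lie_subalgebra (leib_infty R d).
Proof.
split=> [X []//||X Y]; rewrite leib_inftyE.
- exact: isometry_forms_subspace.
- exact: isometry_forms_bracket.
Qed.

Lemma leib_infty_not_finite_dimensional : ~ finite_dimensional (leib_infty R d).
Proof.
move=> [n [z Lz]]; pose y k : M -> M := fun p => (p.1.2 ^+ k, 0, 0).
have Ly k : leib_infty R d (y k).
  rewrite leib_inftyE; exists (fun q => q.1 ^+ k), 0, (fun=> 0), (fun=> 0).
  split; try exact: smooth_cst.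
  - by apply: smoothX; apply: smooth_fst; exact: smooth_id.
  - by move=> t; rewrite trmx0 oppr0.
  - by apply/funext => p; rewrite isometry_formE mul0mx addr0.
have [c [k0 ck0] c0] := finite_dimensional_dependent Lz Ly.
(* The u-component of the dependence at [(0, t, 0)] is a polynomial in [t] that vanishes
   identically. *)
pose P := \poly_(i < n.+1) c (inord i).
have P0 t : P.[t] = 0.
  rewrite horner_poly; have := congr1 (fun X : M -> M => (X (0, t, 0)).1.1) c0.
  rewrite /= fct_sumE !linear_sum /= => cE; rewrite -[RHS]cE.
  by apply: eq_bigr => i _; rewrite inord_val.
have /eqP : P = 0.
  (* [P] has at most n + 1 coefficients and vanishes at the n + 1 points 0, ..., n, which are
     distinct in [R]. *)
  apply: (@roots_geq_poly_eq0 _ P [seq i%:R | i <- iota 0 n.+1]).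
  - by apply/allP => x _; apply/rootP.
  - rewrite map_inj_uniq ?iota_uniq//; exact: mulrIn (oner_neq0 R).
  - by rewrite size_map size_iota size_poly.
move/eqP/polyP/(_ k0); rewrite coef_poly coef0 ltn_ord inord_val => ck.
by rewrite ck eqxx in ck0.
Qed.

End IsometryAlgebra.

(** * Affine and linear vector fields and their brackets *)

Section AffineFields.
Variables (R : realType) (T : normedModType R).
Implicit Types X Y : T -> T.

(** Replaces the bundled linear map by an equation, which is easier to check for sums and brackets.
    Taking [h = 1] and [p = 0] forces [w v = X v - X 0], whence [w] is linear. *)
Lemma affine_vfieldsP X : affine_vfields X <->
  exists w : T -> T, forall h v p, X (h *: v + p) = h *: w v + X p.
Proof.
split=> [[L [c ->]]|[w Xw]].
  by exists L => h v p; rewrite linearP addrA.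
pose L0 p := X p - X 0.
have L0l : linear L0.
  have L0w v : L0 v = w v.
    by have := Xw 1 v 0; rewrite !scale1r addr0 /L0 => ->; rewrite addrK.
  by move=> h v p; rewrite {1}/L0 Xw -addrA -/(L0 p) -L0w.
pose LM := GRing.isLinear.Build _ _ _ _ _ L0l.
pose L : {linear T -> T} := HB.pack L0 LM.
by exists L, (X 0); apply/funext => p; rewrite /= subrK.
Qed.

Lemma derive_affine_vfield (L : {linear T -> T}) c v p :
  'D_v (fun q => L q + c) p = L v.
Proof. by apply: derive_affine => h; rewrite linearP addrA. Qed.

Lemma affine_vfields_subspace : is_subspace (@affine_vfields R T).
Proof.
split; first by apply/affine_vfieldsP; exists (fun=> 0) => h v p; rewrite scaler0 add0r.
move=> c X Y /affine_vfieldsP[w Xw] /affine_vfieldsP[w' Yw].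
apply/affine_vfieldsP; exists (fun v => c *: w v + w' v) => h v p.
rewrite -[LHS]/(c *: X _ + Y _) Xw Yw -[X in _ = _ + X]/(c *: X p + Y p).
by rewrite !scalerDr !scalerA mulrC addrACA.
Qed.

Lemma affine_vfields_bracket X Y :
  affine_vfields X -> affine_vfields Y -> affine_vfields (bracket X Y).
Proof.
move=> [L [c ->]] [L' [c' ->]]; apply/affine_vfieldsP.
exists (fun v => L' (L v) - L (L' v)) => h v p.
rewrite /bracket !derive_affine_vfield (linearP L) (linearP L').
rewrite -!addrA (linearP L) (linearP L').
by rewrite scalerBr opprD -!addrA; congr (_ + _); rewrite addrCA.
Qed.

(** Kept as a bare equation, since the generators come as formulas and not as bundled linear
    maps. *)
Definition linear_vfield X := forall h v p, X (h *: v + p) = h *: X v + X p.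

Lemma derive_linear_vfield X v p : linear_vfield X -> 'D_v X p = X v.
Proof. by move=> Xl; apply: derive_affine => h; exact: Xl. Qed.

(** A linear field is its own derivative, ['D_v Y p = Y v]; the bracket is therefore a commutator of
    compositions in reversed order. *)
Lemma bracket_linear_vfield X Y p : linear_vfield X -> linear_vfield Y ->
  bracket X Y p = Y (X p) - X (Y p).
Proof. by move=> Xl Yl; rewrite /bracket !derive_linear_vfield. Qed.

Lemma bracket_cst_linear_vfield c Y p : linear_vfield Y ->
  bracket (fun=> c) Y p = Y c.
Proof.
by move=> Yl; rewrite /bracket derive_linear_vfield// derive_cst subr0.
Qed.

Lemma linear_vfield_affine X : linear_vfield X -> affine_vfields X.
Proof. by move=> Xl; apply/affine_vfieldsP; exists X. Qed.

Lemma cst_affine_vfield (c : T) : affine_vfields (fun=> c).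
Proof.
by apply/affine_vfieldsP; exists (fun=> 0) => h v p; rewrite scaler0 add0r.
Qed.

End AffineFields.

(** * The generators are affine isometries *)

Section Generators.
Variables (R : realType) (d : nat).
Local Notation M := (spacetime R d).

Lemma gen_CE p : gen_C p = (p.1.2, 0, 0) :> M.
Proof.
by rewrite /gen_C /e_u; congr (_, _, _) => /=; rewrite ?scaler1 ?scaler0.
Qed.

Lemma gen_DE i p : gen_D i p = (p.2 i 0, 0, 0) :> M.
Proof.
by rewrite /gen_D /e_u; congr (_, _, _) => /=; rewrite ?scaler1 ?scaler0.
Qed.

Lemma gen_KE i p :
  gen_K i p = (p.2 i 0, 0, \col_m - (p.1.2 * (m == i)%:R)) :> M.
Proof.
rewrite /gen_K /e_u /e_x; congr (_, _, _) => /=.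
- by rewrite scaler1 scaler0 subr0.
- by rewrite !scaler0 subr0.
- by rewrite scaler0 sub0r; apply/colP => m; rewrite !mxE andbT.
Qed.

Lemma gen_JE i j p : gen_J i j p =
  (0, 0, \col_m (p.2 i 0 * (m == j)%:R - p.2 j 0 * (m == i)%:R)) :> M.
Proof.
rewrite /gen_J /e_x; congr (_, _, _) => /=.
- by rewrite !scaler0 subr0.
- by rewrite !scaler0 subr0.
- by apply/colP => m; rewrite !mxE !andbT.
Qed.

Lemma gen_C_linear : linear_vfield (@gen_C R d).
Proof.
move=> h v p; rewrite !gen_CE; congr (_, _, _) => /=; by rewrite ?scaler0 ?addr0.
Qed.

Lemma gen_D_linear i : linear_vfield (@gen_D R d i).
Proof.
by move=> h v p; rewrite !gen_DE; congr (_, _, _) => /=;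
  rewrite ?scaler0 ?addr0 // !mxE.
Qed.

Lemma gen_K_linear i : linear_vfield (@gen_K R d i).
Proof.
move=> h v p; rewrite !gen_KE; congr (_, _, _) => /=.
- by rewrite !mxE.
- by rewrite scaler0 addr0.
- by apply/colP => m; rewrite !mxE -[h *: v.1.2]/(h * v.1.2); ring.
Qed.

Lemma gen_J_linear i j : linear_vfield (@gen_J R d i j).
Proof.
move=> h v p; rewrite !gen_JE; congr (_, _, _) => /=.
- by rewrite scaler0 addr0.
- by rewrite scaler0 addr0.
- by apply/colP => m; rewrite !mxE; ring.
Qed.

Lemma generator_affine X : generators R d X -> affine_vfields X.
Proof.
move=> [[[[[[->|->]|[i _ <-]]|->]|[i _ <-]]|[i _ <-]]|[i [j ->]]].
- exact: cst_affine_vfield.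
- exact: cst_affine_vfield.
- exact: cst_affine_vfield.
- exact/linear_vfield_affine/gen_C_linear.
- exact/linear_vfield_affine/gen_D_linear.
- exact/linear_vfield_affine/gen_K_linear.
- exact/linear_vfield_affine/gen_J_linear.
Qed.

Lemma isometry_form0E (a : R * 'cV[R]_d -> R) tau (b : R -> 'cV[R]_d) p :
  isometry_form a tau (fun=> 0) b p = (a (p.1.2, p.2), tau, b p.1.2).
Proof. by rewrite isometry_formE mul0mx add0r. Qed.

(** Serves every generator except the rotations [gen_J]: the others have lambda = 0. *)
Lemma isometry_forms0 (a : R * 'cV[R]_d -> R) tau (b : R -> 'cV[R]_d) X :
  smooth a -> smooth b -> (forall p, X p = (a (p.1.2, p.2), tau, b p.1.2)) ->
  isometry_forms R d X.
Proof.
move=> sa sb XE; exists a, tau, (fun=> 0), b; split=> //.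
- exact: smooth_cst.
- by move=> t; rewrite trmx0 oppr0.
- by apply/funext => p; rewrite isometry_form0E XE.
Qed.

Lemma generator_isometry X : generators R d X -> isometry_forms R d X.
Proof.
have sx i : smooth (fun q : R * 'cV[R]_d => q.2 i 0).
  by apply: smooth_entry; apply: smooth_snd; exact: smooth_id.
move=> [[[[[[->|->]|[i _ <-]]|->]|[i _ <-]]|[i _ <-]]|[i [j ->]]].
- by apply: (@isometry_forms0 (fun=> 1) 0 (fun=> 0)) => //; exact: smooth_cst.
- by apply: (@isometry_forms0 (fun=> 0) 1 (fun=> 0)) => //; exact: smooth_cst.
- by apply: (@isometry_forms0 (fun=> 0) 0 (fun=> delta_mx i 0)) => //; exact: smooth_cst.
- apply: (@isometry_forms0 fst 0 (fun=> 0)); [|exact: smooth_cst|exact: gen_CE].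
  by apply: smooth_fst; exact: smooth_id.
- apply: (@isometry_forms0 (fun q => q.2 i 0) 0 (fun=> 0)) => //.
    exact: smooth_cst.
  exact: gen_DE.
- apply: (@isometry_forms0 (fun q => q.2 i 0) 0
    (fun t => \col_m - (t * (m == i)%:R))) => //; last exact: gen_KE.
  apply: smooth_mx => m k; rewrite (_ : (fun t => _) = fun t => - (t * (m == i)%:R)).
    by apply/smoothN/smoothM; [exact: smooth_id|exact: smooth_cst].
  by apply/funext => t; rewrite mxE.
(* The rotation x_i d/dx^j - x_j d/dx^i is x |-> (E_ji - E_ij) x, with E the elementary matrices. *)
- exists (fun=> 0), 0, (fun=> delta_mx j i - delta_mx i j), (fun=> 0).
  split; try exact: smooth_cst.
    by move=> t; rewrite linearB/= !trmx_delta opprB.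
  apply/funext => p; rewrite isometry_formE gen_JE addr0; congr (_, _, _).
  rewrite mulmxBl; apply/colP => m.
  have dE (k l : 'I_d) : (delta_mx k l *m p.2) m 0 = p.2 l 0 * (m == k)%:R.
    rewrite mxE (bigD1 l)//= big1 => [|n nl]; rewrite mxE.
      by rewrite eqxx andbT addr0 mulrC.
    by rewrite (negPf nl) andbF mul0r.
  by rewrite mxB_entry !dE mxE.
Qed.

Lemma generator_leib X : generators R d X -> leib R d X.
Proof.
move=> gX; split; last exact: generator_affine.
by rewrite leib_inftyE; exact: generator_isometry.
Qed.

Lemma leib_lie : is_lie_subalgebra (leib R d).
Proof.
have [infS infsub infbr] := leib_infty_lie R d.
split.
- by move=> X [/infS].
- have [aff0 affL] := @affine_vfields_subspace R M; case: infsub => [inf0 infL].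
  split; first by split; [exact: inf0|exact: aff0].
  move=> c X Y [iX aX] [iY aY]; split; [exact: infL|exact: affL].
- move=> X Y [iX aX] [iY aY]; split; first exact: infbr.
  exact: affine_vfields_bracket.
Qed.

Lemma generators_finite : finite_set (generators R d).
Proof.
rewrite /generators /fam_M /fam_H /fam_P /fam_C /fam_D /fam_K.
rewrite !finite_setU; repeat split; try exact: finite_set1;
  try exact: finite_image.
rewrite (_ : fam_J R d = range (fun ij => gen_J ij.1 ij.2)).
  exact: finite_image.
apply/seteqP; split=> [X [i [j ->]]|X [[i j] _ <-]]; last by exists i, j.
by exists (i, j).
Qed.

Lemma finite_lspan (S : set (M -> M)) : finite_set S -> finite_dimensional (lspan S).
Proof.
move=> /finite_seqP[s ->]; exists (size s), (fun i => s`_i).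
congr lspan; apply/seteqP; split=> [x /= xs|_ [i _ <-]]; last exact: mem_nth.
have xi : (index x s < size s)%N by rewrite index_mem.
by exists (Ordinal xi) => //=; rewrite nth_index.
Qed.

End Generators.

(** * Affine isometries: span of the generators and vanishing second derivatives *)

Section Leib.
Variables (R : realType) (d : nat).
Local Notation M := (spacetime R d).

Lemma sum_gen_P (b : 'cV[R]_d) p :
  (\sum_i b i 0 *: @gen_P R d i) p = (0, 0, b).
Proof.
rewrite fct_sumE -[LHS]/(\sum_i b i 0 *: @e_x R d i) sum_e_x.
by congr (_, _, _); apply/colP => i; rewrite mxE.
Qed.

Lemma sum_gen_D (k : 'I_d -> R) p :
  (\sum_i k i *: @gen_D R d i) p = (\sum_i k i * p.2 i 0, 0, 0).
Proof.
rewrite fct_sumE -[LHS]/(\sum_i k i *: gen_D i p).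
under eq_bigr do rewrite gen_DE.
rewrite [LHS]surjective_pairing [X in (X, _)]surjective_pairing !linear_sum /=.
by congr (_, _, _); apply: big1 => i _; rewrite scaler0.
Qed.

Lemma sum_gen_DK (b : 'cV[R]_d) p :
  (\sum_i b i 0 *: (@gen_D R d i - @gen_K R d i)) p = (0, 0, p.1.2 *: b).
Proof.
rewrite fct_sumE -[LHS]/(\sum_i b i 0 *: (gen_D i p - gen_K i p)).
rewrite (eq_bigr (fun i => (p.1.2 *: b) i 0 *: @e_x R d i)) => [|i _].
  by rewrite sum_e_x; congr (_, _, _); apply/colP => i; rewrite !mxE.
by rewrite /gen_D /gen_K opprB addrC subrK scalerA mxE [b i 0 * _]mulrC.
Qed.

(* For antisymmetric A, the rotation field x |-> A x is half the sum of the
   A i j x^j e_i - A i j x^i e_j. *)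
Lemma sum_gen_J (A : 'M[R]_d) p : A^T = - A ->
  (\sum_i \sum_j (2^-1 * A i j) *: @gen_J R d j i) p = (0, 0, A *m p.2).
Proof.
move=> sA; have Aij i j : A i j = - A j i.
  by have /matrixP/(_ j i) := sA; rewrite !mxE.
rewrite fct_sumE.
under eq_bigr do rewrite fct_sumE.
rewrite -[LHS]/(\sum_i \sum_j (2^-1 * A i j) *: gen_J j i p).
under eq_bigr => i _ do under eq_bigr => j _ do rewrite /gen_J scalerBr !scalerA.
under eq_bigr do rewrite sumrB.
(* Swapping the indices in the second half puts both halves on [e_x i]; antisymmetry then makes them
   equal, and the factor 1/2 compensates. *)
rewrite sumrB [X in _ - X]exchange_big -sumrB/=.
rewrite (eq_bigr (fun i => (A *m p.2) i 0 *: @e_x R d i)) => [|i _].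
  by rewrite sum_e_x; congr (_, _, _); apply/colP => i; rewrite mxE.
rewrite -!scaler_suml -scalerBl -sumrB mxE; congr (_ *: _).
apply: eq_bigr => j _; rewrite [A j i]Aij /x_coord mulrN mulNr opprK.
rewrite -mulrDl -mulrDl -[2^-1]mul1r -mulrDl -[1 + 1]/(2 : R).
by rewrite divff ?mul1r// pnatr_eq0.
Qed.

(** An affine field is determined by its values at the origin and at the coordinate vectors, so the
    normal form is evaluated only there. Affinity of a and b and constancy of lambda are never
    established separately: [a0], [a1], [k], [b1] and [l 0] already determine X. *)
Lemma leib_in_span X : leib R d X -> lspan (generators R d) X.
Proof.
move=> [+ [L [c XE]]]; rewrite leib_inftyE.
move=> [a [tau [l [b [_ _ _ ls Xform]]]]].
pose a0 := a (0, 0); pose a1 := a (1, 0) - a0; pose b1 := b 1 - b 0.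
pose k i := a (0, delta_mx i 0) - a0.
have X0 : c = (a0, tau, b 0).
  have := congr1 (fun Z : M -> M => Z 0) XE.
  by rewrite /= Xform isometry_formE /= mulmx0 add0r linear0 add0r.
have LE v : L v = X v - c by rewrite XE addrK.
have Lu : L (@e_u R d) = 0.
  rewrite LE X0 Xform isometry_formE /= mulmx0 add0r.
  by rewrite subrr.
have Lt : L (@e_t R d) = (a1, 0, b1).
  rewrite LE X0 Xform isometry_formE /= mulmx0 add0r.
  by congr (_, _, _); rewrite /= subrr.
have Lx i : L (@e_x R d i) = (k i, 0, l 0 *m delta_mx i 0).
  rewrite LE X0 Xform isometry_formE /=.
  by congr (_, _, _); rewrite /= ?subrr ?addrK.
have -> : X = a0 *: @gen_M R d + tau *: @gen_H R d + a1 *: @gen_C R d +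
    \sum_i b 0 i 0 *: @gen_P R d i + \sum_i k i *: @gen_D R d i +
    \sum_i b1 i 0 *: (@gen_D R d i - @gen_K R d i) +
    \sum_i \sum_j (2^-1 * l 0 i j) *: @gen_J R d j i.
  apply/funext => p.
  rewrite [RHS](_ : _ = a0 *: @gen_M R d p + tau *: @gen_H R d p +
    a1 *: @gen_C R d p +
    (\sum_i b 0 i 0 *: @gen_P R d i) p + (\sum_i k i *: @gen_D R d i) p +
    (\sum_i b1 i 0 *: (@gen_D R d i - @gen_K R d i)) p +
    (\sum_i \sum_j (2^-1 * l 0 i j) *: @gen_J R d j i) p)//.
  rewrite sum_gen_P sum_gen_D sum_gen_DK sum_gen_J// gen_CE XE.
  rewrite [in L p](coord_expansion p) !linearD !linearZ/= Lu Lt scaler0 add0r.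
  rewrite linear_sum X0 /=.
  have -> : \sum_i L (p.2 i 0 *: @e_x R d i) =
      (\sum_i k i * p.2 i 0, 0, l 0 *m p.2).
    rewrite [LHS]surjective_pairing [X in (X, _)]surjective_pairing !linear_sum /=.
    congr (_, _, _).
    - by apply: eq_bigr => i _; rewrite linearZ Lx /= mulrC.
    - by apply: big1 => i _; rewrite linearZ Lx /= scaler0.
    - rewrite {2}[p.2]matrix_sum_delta linear_sum/=; apply: eq_bigr => i _.
      by rewrite linearZ Lx /= big_ord1 -scalemxAr.
  rewrite /gen_M /gen_H /e_u /e_t; congr (_, _, _) => /=.
  - rewrite !scaler1 !scaler0 !addr0 -[p.1.2 *: a1]/(p.1.2 * a1).
    by rewrite -[a1 *: p.1.2]/(a1 * p.1.2); ring.
  - by rewrite !scaler1 !scaler0 !addr0 !add0r.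
  - by rewrite !scaler0 !addr0 !add0r -scalerDr -[RHS]addrA [RHS]addrC.
have sp := lspan_subspace (generators R d).
have sg Z : generators R d Z -> lspan (generators R d) Z by exact: lspan_incl.
have gD i : generators R d (gen_D i) by do 2 left; right; exists i.
have gK i : generators R d (gen_K i) by left; right; exists i.
have lZ (e : R) Z : generators R d Z -> lspan (generators R d) (e *: Z).
  by move=> gZ; apply: subspaceZ => //; exact: sg.
apply: (subspaceD sp); last first.
  apply: subspace_sum => // i; apply: subspace_sum => // j.
  by apply: lZ; right; exists j, i.
apply: (subspaceD sp); last first.
  apply: subspace_sum => // i; apply: subspaceZ => //.
  by apply: subspaceB => //; exact: sg.
apply: (subspaceD sp); last first.
  by apply: subspace_sum => // i; exact: lZ.
apply: (subspaceD sp); last first.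
  by apply: subspace_sum => // i; apply: lZ; do 4 left; right; exists i.
apply: (subspaceD sp); last by apply: lZ; do 3 left; right.
by apply: (subspaceD sp); apply: lZ; [do 6 left|do 5 left; right].
Qed.

Lemma leibE : leib R d = lspan (generators R d).
Proof.
apply/seteqP; split; first exact: leib_in_span.
by apply: lspan_min; [case: (leib_lie R d)|exact: generator_leib].
Qed.

(** The derivative along the displacement [p] itself is a combination of coordinate derivatives, so
    translating 0 by [p] changes nothing. *)
Lemma derive_coord_eq0 (X : M -> M) : smooth X ->
  (forall v, coord_vectors R d v -> forall p, 'D_v X p = 0) ->
  forall p, X p = X 0.
Proof.
move=> sX X0 p; rewrite -{1}[p]addr0; apply: derive_shift_field => // q.
have dX : differentiable X q by exact: smooth_diff.
rewrite (coord_expansion p) !deriveD_dir// !deriveZ_dir// derive_sum_dir//.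
rewrite !X0 ?scaler0 ?addr0 ?add0r; [|by left; right|by left; left].
by apply: big1 => i _; rewrite deriveZ_dir// X0 ?scaler0//; right; exists i.
Qed.

Lemma leib_second_derivatives : leib R d = [set X | leib_infty R d X /\
  forall v w, coord_vectors R d v -> coord_vectors R d w ->
  forall p, 'D_v ('D_w X) p = 0].
Proof.
apply/seteqP; split=> X [LX].
  move=> [L [c XE]]; split=> // v w _ _ p.
  rewrite (_ : 'D_w X = fun=> L w); first exact: derive_cst.
  by apply/funext => q; rewrite XE derive_affine_vfield.
move=> D2; split=> //; have [sX _ _ _] := LX.
have dX0 : differentiable X 0 by exact: smooth_diff.
have Lc : continuous ('d X 0) by exact: diff_continuous.
exists ('d X 0), (X 0).
(* Vanishing second derivatives make each coordinate derivative ['D_w X] constant. *)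
have DX w q : coord_vectors R d w -> 'D_w X q = 'D_w X 0.
  move=> cw; apply: (@derive_coord_eq0 ('D_w X)); first exact: smooth_derive.
  by move=> v cv p; exact: D2.
have sL : smooth ('d X 0) by exact: smooth_linear.
(* Subtracting the differential at 0 removes the constant first derivatives, so the remainder is the
   constant [X 0]. *)
pose Z p := X p - 'd X 0 p.
have sZ : smooth Z by exact: smoothB.
have Z0 p : Z p = Z 0.
  apply: derive_coord_eq0 => // w cw q.
  rewrite deriveB; [|exact: smooth_derivable..].
  rewrite DX// deriveE// (@derive_affine _ _ _ ('d X 0) w ('d X 0 w)) ?subrr//.
  by move=> h; rewrite linearP.
apply/funext => p; have := Z0 p; rewrite /Z linear0 subr0 => <-.
by rewrite addrC subrK.
Qed.

End Leib.

(** * Structure constants of the generators *)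

Section Brackets.
Variables (R : realType) (d : nat).
Local Notation M := (spacetime R d).
Local Notation delta i j := ((i == j)%:R : R).

Lemma bracket_HC : bracket (@gen_H R d) (@gen_C R d) = @gen_M R d.
Proof.
apply/funext => p; rewrite bracket_cst_linear_vfield; last exact: gen_C_linear.
by rewrite gen_CE.
Qed.

Lemma bracket_PK i j :
  bracket (@gen_P R d i) (@gen_K R d j) = delta i j *: @gen_M R d.
Proof.
apply/funext => p; rewrite bracket_cst_linear_vfield; last exact: gen_K_linear.
rewrite gen_KE; congr (_, _, _) => /=; rewrite ?scaler0//.
  by rewrite mxE eqxx andbT scaler1 eq_sym.
by apply/colP => m; rewrite !mxE mul0r oppr0.
Qed.

Lemma bracket_PD i j :
  bracket (@gen_P R d i) (@gen_D R d j) = delta i j *: @gen_M R d.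
Proof.
apply/funext => p; rewrite bracket_cst_linear_vfield; last exact: gen_D_linear.
rewrite gen_DE; congr (_, _, _) => /=; rewrite ?scaler0//.
by rewrite mxE eqxx andbT scaler1 eq_sym.
Qed.

Lemma bracket_HK i : bracket (@gen_H R d) (@gen_K R d i) = - @gen_P R d i.
Proof.
apply/funext => p; rewrite bracket_cst_linear_vfield; last exact: gen_K_linear.
rewrite gen_KE; congr (_, _, _) => /=; rewrite ?oppr0 ?mxE//.
by apply/colP => m; rewrite !mxE mul1r andbT.
Qed.

(** [gen_D i p] lies along [e_u], where [gen_K j] vanishes; only minus [gen_D i] of [gen_K j p]
    contributes, and the minus sign in K turns the result into + t d/du. *)
Lemma bracket_DK i j :
  bracket (@gen_D R d i) (@gen_K R d j) = delta i j *: @gen_C R d.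
Proof.
apply/funext => p.
rewrite bracket_linear_vfield; [|exact: gen_D_linear|exact: gen_K_linear].
rewrite [RHS](_ : _ = delta i j *: gen_C p)// gen_CE !gen_KE !gen_DE /=.
congr (_, _, _) => /=; rewrite ?scaler0 ?subr0// ?mxE.
  by rewrite opprK add0r [RHS]mulrC.
by apply/colP => m; rewrite !mxE mul0r oppr0.
Qed.

(** J rotates the index [k] as a vector index, which is why K and D obey the same formula with the
    same coefficients. *)
Lemma bracket_PJ k i j : bracket (@gen_P R d k) (@gen_J R d i j) =
  delta i k *: @gen_P R d j - delta j k *: @gen_P R d i.
Proof.
apply/funext => p; rewrite bracket_cst_linear_vfield; last exact: gen_J_linear.
rewrite [RHS](_ : _ = delta i k *: @gen_P R d j p - delta j k *: @gen_P R d i p)//.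
rewrite gen_JE /gen_P /e_x; congr (_, _, _) => /=; rewrite ?scaler0 ?subr0//.
by apply/colP => m; rewrite !mxE !andbT.
Qed.

Lemma bracket_KJ k i j : bracket (@gen_K R d k) (@gen_J R d i j) =
  delta i k *: @gen_K R d j - delta j k *: @gen_K R d i.
Proof.
apply/funext => p.
rewrite bracket_linear_vfield; [|exact: gen_K_linear|exact: gen_J_linear].
rewrite [RHS](_ : _ = delta i k *: gen_K j p - delta j k *: gen_K i p)//.
rewrite !gen_KE !gen_JE; congr (_, _, _) => /=.
(* [eq_sym] orients the Kronecker deltas alike, so that [ring] sees equal ones as one atom. *)
- by rewrite !mxE ![k == _]eq_sym -![_ *: (_ : R)]/(_ * _); ring.
- by rewrite !scaler0.
- by apply/colP => m; rewrite !mxE; ring.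
Qed.

Lemma bracket_DJ k i j : bracket (@gen_D R d k) (@gen_J R d i j) =
  delta i k *: @gen_D R d j - delta j k *: @gen_D R d i.
Proof.
apply/funext => p.
rewrite bracket_linear_vfield; [|exact: gen_D_linear|exact: gen_J_linear].
rewrite [RHS](_ : _ = delta i k *: gen_D j p - delta j k *: gen_D i p)//.
rewrite !gen_DE !gen_JE; congr (_, _, _) => /=.
- by rewrite !mxE ![k == _]eq_sym -![_ *: (_ : R)]/(_ * _); ring.
- by rewrite !scaler0.
- by apply/colP => m; rewrite !mxE; ring.
Qed.

(** The relations of so(d): the first pair of terms is the action of [gen_J i j] on the index [k],
    the second its action on [l], rewritten with J antisymmetric. *)
Lemma bracket_JJ i j k l : bracket (@gen_J R d i j) (@gen_J R d k l) =
  (delta j k *: @gen_J R d i l - delta i k *: @gen_J R d j l) +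
  (delta i l *: @gen_J R d j k - delta j l *: @gen_J R d i k).
Proof.
apply/funext => p.
rewrite bracket_linear_vfield; [|exact: gen_J_linear..].
rewrite [RHS](_ : _ = (delta j k *: gen_J i l p - delta i k *: gen_J j l p) +
  (delta i l *: gen_J j k p - delta j l *: gen_J i k p))//.
rewrite !gen_JE; congr (_, _, _) => /=.
- by rewrite !scaler0 !subr0 addr0.
- by rewrite !scaler0 !subr0 addr0.
- by apply/colP => m; rewrite !mxE ![k == _]eq_sym ![l == _]eq_sym; ring.
Qed.

End Brackets.

Theorem proposition2p18 (R : realType) (d : nat) :
  ([/\ is_lie_subalgebra (leib_infty R d),
       ~ finite_dimensional (leib_infty R d),
       leib_infty R d = lspan (isometry_forms R d)
     & leib_infty R d = isometry_forms R d])
  /\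
  ([/\ is_lie_subalgebra (leib R d),
       finite_dimensional (leib R d),
       leib R d = [set X | leib_infty R d X /\
                     forall v w, coord_vectors R d v -> coord_vectors R d w ->
                       forall p, 'D_v ('D_w X) p = 0]
     & leib R d = lspan (generators R d)]
   /\
   [/\ bracket_sim (fam_H R d) (fam_C R d) (fam_M R d),
       bracket_sim (fam_P R d) (fam_K R d) (fam_M R d)
     & bracket_sim (fam_P R d) (fam_D R d) (fam_M R d)]
   /\
   [/\ bracket_sim (fam_H R d) (fam_K R d) (fam_P R d),
       bracket_sim (fam_D R d) (fam_K R d) (fam_C R d)
     & bracket_sim (fam_P R d) (fam_J R d) (fam_P R d)]
   /\
   [/\ bracket_sim (fam_K R d) (fam_J R d) (fam_K R d),
       bracket_sim (fam_D R d) (fam_J R d) (fam_D R d)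
     & bracket_sim (fam_J R d) (fam_J R d) (fam_J R d)]).
Proof.
have span := @lspan_subspace R (spacetime R d -> spacetime R d).
have incl := @lspan_incl R (spacetime R d -> spacetime R d).
(* The common shape of the brackets of P, K and D with J; J with J is a sum of two such
   differences. *)
have lin (S : set (spacetime R d -> spacetime R d)) (a b : R) X Y :
    S X -> S Y -> lspan S (a *: X - b *: Y).
  by move=> SX SY; apply: subspaceB => //; apply: subspaceZ => //; exact: incl.
split; [split|split; [split|split; [|split]]].
- exact: leib_infty_lie.
- exact: leib_infty_not_finite_dimensional.
(* The normal forms are already a subspace, so being spanned by them and being of that form
   coincide. *)
- by rewrite lspan_id ?leib_inftyE//; exact: isometry_forms_subspace.
- exact: leib_inftyE.
- exact: leib_lie.
- by rewrite leibE; apply: finite_lspan; exact: generators_finite.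
- exact: leib_second_derivatives.
- exact: leibE.
- split=> X Y.
  + by move=> -> ->; rewrite bracket_HC; exact: incl.
  + move=> [i _ <-] [j _ <-]; rewrite bracket_PK.
    by apply: subspaceZ => //; exact: incl.
  + move=> [i _ <-] [j _ <-]; rewrite bracket_PD.
    by apply: subspaceZ => //; exact: incl.
- split=> X Y.
  + move=> -> [i _ <-]; rewrite bracket_HK.
    by apply: subspaceN => //; apply: incl; exists i.
  + move=> [i _ <-] [j _ <-]; rewrite bracket_DK.
    by apply: subspaceZ => //; exact: incl.
  + move=> [k _ <-] [i [j ->]]; rewrite bracket_PJ.
    by apply: lin; [exists j|exists i].
- split=> X Y.
  + move=> [k _ <-] [i [j ->]]; rewrite bracket_KJ.
    by apply: lin; [exists j|exists i].
  + move=> [k _ <-] [i [j ->]]; rewrite bracket_DJ.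
    by apply: lin; [exists j|exists i].
  + move=> [i [j ->]] [k [l ->]]; rewrite bracket_JJ.
    by apply: subspaceD => //; apply: lin; do 2 eexists.
Qed.
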